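(* Let $\mathcal{V}$ be a set of $n \geq 24$ points in $\mathbb{C}^3$ not contained in a (complex affine) plane. If no plane contains $n-1$ points of $\mathcal{V}$, then $\mathcal{V}$ determines at least $\frac{3}{2}n$ ordinary lines; if some plane contains $n-1$ points of $\mathcal{V}$, then $\mathcal{V}$ determines at least $n-1$ ordinary lines.
   Context: A line is determined by $\mathcal{V}$ if it contains at least two points of $\mathcal{V}$. An ordinary line is a (complex affine) line containing exactly two points of $\mathcal{V}$. *)

(* Defs.v *)
From HB Require Import structures.
From mathcomp Require Import all_boot all_order all_algebra.
From mathcomp Require Import finmap.
From mathcomp Require Import boolp classical_sets functions cardinality reals.
From mathcomp Require Import complex.

Set Implicit Arguments.
Unset Strict Implicit.
Unset Printing Implicit Defensive.

Import Order.TTheory GRing.Theory Num.Theory.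

Local Open Scope classical_set_scope.
Local Open Scope fset_scope.
Local Open Scope ring_scope.

Section Flats.
Variables (F : fieldType) (d : nat).
Implicit Types (A : set 'rV[F]_d) (V : {fset 'rV[F]_d}).

(* [A] is a translate of the row space of a [k]-by-[d] matrix of rank [k]. *)
Definition affine_flat (k : nat) A : Prop :=
  exists (p : 'rV[F]_d) (M : 'M[F]_(k, d)),
    row_free M /\ A = [set x | (x - p <= M)%MS].

Definition is_line A : Prop := affine_flat 1 A.
Definition is_plane A : Prop := affine_flat 2 A.

Definition points_in V A : {fset 'rV[F]_d} := [fset x in V | x \in A].

Definition ordinary_lines V : set (set 'rV[F]_d) :=
  [set L | is_line L /\ #|` points_in V L| = 2].

(* [fset_set] is empty on infinite sets; this set is finite, since a line is
   determined by any two of its points. *)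
Definition num_ordinary_lines V : nat := #|` fset_set (ordinary_lines V)|.

End Flats.

(* Main.v *)
Require Import Defs.
From HB Require Import structures.
From mathcomp Require Import all_boot all_order all_algebra.
From mathcomp Require Import finmap.
From mathcomp Require Import boolp classical_sets functions cardinality reals.
From mathcomp Require Import complex.
From mathcomp Require Import fingroup perm exp.
From mathcomp Require Import zify ring lra.

Set Implicit Arguments.
Unset Strict Implicit.
Unset Printing Implicit Defensive.

Import Order.TTheory GRing.Theory Num.Theory.

Local Open Scope ring_scope.

(** Lift the points to vectors [w i] of [C^4]. If no subspace contains more than
    its proportional share of them, the potential
    [n ln |det T|^2 - 4 \sum_i ln |w i T|^2] is bounded above on invertible
    matrices, and near-maximality of [T] forces the normalised images [u i] of
    the [w i] to be almost isotropic: [\sum_(i, j) |<u i, u j>|^2 <= n^2/4 + e].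
    On the other hand the [r] points of a line span only two dimensions, so they
    contribute at least [r^2/2], that is, at least [1/4] per ordered pair of
    distinct points as soon as [r >= 3]. Comparing, at least [3n] ordered pairs lie on
    ordinary lines. In the remaining case some plane misses only [k] points,
    with [2k + 3 <= n], and each of these lies on at least [n - 2k + 1] ordinary
    lines meeting the plane in a point of the set. *)

(** * Comparing sums through counts of sublevel sets *)

Section Majorization.
Variable R : realDomainType.

(** The heads are the maxima: [a < b] would put all of [s], but not all of [t], below [a]. The count
    hypothesis survives removing both heads: the only delicate case is [b <= x < a], and then the
    whole tail of [t] lies below [x]. *)
Lemma le_sum_of_sorted_count (s t : seq R) :
    sorted >=%R s -> sorted >=%R t -> size s = size t ->
    (forall x, (count (<= x) s <= count (<= x) t)%N) ->
  \sum_(y <- t) y <= \sum_(y <- s) y.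
Proof.
elim: s t => [|a s IH] [|b t] //= sa sb [hsz] hc.
have le_trans' : transitive (>=%R : rel R) by move=> y x z h1 h2; exact: le_trans h2 h1.
have ha : all (<= a) s by exact: (order_path_min le_trans' sa).
have hb : all (<= b) t by exact: (order_path_min le_trans' sb).
have hba : b <= a.
  rewrite leNgt; apply/negP => hab.
  have := hc a; rewrite lexx (leNgt b) hab /= add0n.
  have := count_size (<= a) t; move: ha; rewrite all_count => /eqP ->.
  by rewrite hsz => h1 h2; have := leq_trans h2 h1; rewrite ltnn.
rewrite !big_cons lerD //; apply: IH => //.
- exact: path_sorted sa.
- exact: path_sorted sb.
- move=> x; have := hc x; have := count_size (<= x) s.
  have [hax|hax] /= := boolP (a <= x); first by rewrite (le_trans hba hax).
  rewrite add0n; have [hbx|hbx] := boolP (b <= x); rewrite ?add0n //.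
  have -> : count (<= x) t = size t; last by lia.
  apply/eqP; rewrite -all_count; apply: sub_all hb => y /= yb.
  exact: le_trans yb hbx.
Qed.

Lemma le_sum_of_count (s t : seq R) : size s = size t ->
    (forall x, (count (<= x) s <= count (<= x) t)%N) ->
  \sum_(y <- t) y <= \sum_(y <- s) y.
Proof.
move=> hsz hc.
have tot : total (>=%R : rel R) by move=> x y; exact: le_total.
have ps (u : seq R) : perm_eq u (sort >=%R u) by rewrite perm_sym perm_sort.
rewrite (perm_big _ (ps t)) (perm_big _ (ps s)).
apply: le_sum_of_sorted_count; rewrite ?sort_sorted ?size_sort // => x.
by have /seq.permP <- := ps s; have /seq.permP <- := ps t.
Qed.

(** Both families are pulled back to [I * J], where each [a i] occurs [#|J|] times and each [b j]
    occurs [#|I|] times, so that lists of equal length are compared. *)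
Lemma le_sum_of_sublevel_card (I J : finType) (a : I -> R) (b : J -> R) :
    (forall x, (#|J| * #|[pred i | (a i <= x)%R]| <= #|I| * #|[pred j | (b j <= x)%R]|)%N) ->
  #|I|%:R * \sum_j b j <= #|J|%:R * \sum_i a i.
Proof.
move=> h.
have cnt (K : finType) (f : K -> R) x :
    count (<= x) (map f (index_enum K)) = #|[pred k | f k <= x]|.
  by rewrite count_map -sum1_count -sum1_card.
have := @le_sum_of_count (map (fun p : I * J => a p.1) (index_enum (I * J)%type))
  (map (fun p : I * J => b p.2) (index_enum (I * J)%type)).
rewrite !size_map => /(_ erefl); rewrite !big_map.
have -> : \sum_(p : I * J) b p.2 = #|I|%:R * \sum_j b j.
  rewrite -(pair_bigA _ (fun _ j => b j)) /= sumr_const mulr_natl //.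
have -> : \sum_(p : I * J) a p.1 = #|J|%:R * \sum_i a i.
  rewrite -(pair_bigA _ (fun i _ => a i)) /= mulr_sumr.
  by apply: eq_bigr => i _; rewrite sumr_const mulr_natl.
apply => x; rewrite !cnt.
have -> : #|[pred p : I * J | a p.1 <= x]| = (#|J| * #|[pred i | (a i <= x)%R]|)%N.
  rewrite mulnC -[#|J|]/#|predT| -cardX.
  by apply: eq_card => p; rewrite !inE andbT.
have -> : #|[pred p : I * J | b p.2 <= x]| = (#|I| * #|[pred i | (b i <= x)%R]|)%N.
  rewrite -[#|I|]/#|predT| -cardX.
  by apply: eq_card => p; rewrite !inE.
exact: h.
Qed.

End Majorization.

(** * Squared moduli and norms, and a determinant bound *)

Section SquaredModulus.
Variable R : realType.
Local Notation C := R[i].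
Implicit Types z u : C.

Definition sqmodc z : R := complex.Re z ^+ 2 + complex.Im z ^+ 2.

Definition sqnorm d (y : 'rV[C]_d) : R := \sum_a sqmodc (y 0 a).

Lemma sqmodc_ge0 z : 0 <= sqmodc z.
Proof. by rewrite addr_ge0 ?sqr_ge0. Qed.

Lemma sqmodcM z u : sqmodc (z * u) = sqmodc z * sqmodc u.
Proof. by case: z => a b; case: u => c d; rewrite /sqmodc /=; ring. Qed.

Lemma sqmodc0 : sqmodc 0 = 0.
Proof. by rewrite /sqmodc /= expr0n /= addr0. Qed.

Lemma sqmodc1 : sqmodc 1 = 1.
Proof. by rewrite /sqmodc /= expr1n expr0n /= addr0. Qed.

Lemma sqmodc_eq0 z : (sqmodc z == 0) = (z == 0).
Proof.
by case: z => a b; rewrite /sqmodc paddr_eq0 ?sqr_ge0 //= !sqrf_eq0 eq_complex.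
Qed.

Lemma sqmodc_gt0 z : (0 < sqmodc z) = (z != 0).
Proof. by rewrite lt_def sqmodc_ge0 andbT sqmodc_eq0. Qed.

Lemma sqmodc_sign (b : bool) : sqmodc ((-1) ^+ b) = 1.
Proof. by case: b; rewrite /sqmodc /= ?expr1 /=; ring. Qed.

Lemma sqmodc_prod (I : finType) (F : I -> C) :
  sqmodc (\prod_i F i) = \prod_i sqmodc (F i).
Proof. exact: (big_morph _ sqmodcM sqmodc1). Qed.

Lemma sqmodcD_le z u : sqmodc (z + u) <= 2 * (sqmodc z + sqmodc u).
Proof.
case: z => a b; case: u => c d; rewrite /sqmodc /= -subr_ge0.
have -> : 2 * (a ^+ 2 + b ^+ 2 + (c ^+ 2 + d ^+ 2)) -
    ((a + c) ^+ 2 + (b + d) ^+ 2) = (a - c) ^+ 2 + (b - d) ^+ 2 by ring.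
by rewrite addr_ge0 ?sqr_ge0.
Qed.

Lemma sqmodc_sum_le (T : Type) (s : seq T) (F : T -> C) :
  sqmodc (\sum_(i <- s) F i) <= 2 ^+ size s * \sum_(i <- s) sqmodc (F i).
Proof.
elim: s => [|x s IH]; first by rewrite !big_nil sqmodc0 mulr0.
rewrite !big_cons /= exprS -mulrA (le_trans (sqmodcD_le _ _)) // ler_pM2l //.
rewrite mulrDr lerD //.
by rewrite ler_peMl ?sqmodc_ge0 // exprn_ege1 // ler1n.
Qed.

Lemma sqnorm_ge0 d (y : 'rV[C]_d) : 0 <= sqnorm y.
Proof. by apply: sumr_ge0 => a _; exact: sqmodc_ge0. Qed.

Lemma sqmodc_le_sqnorm d (y : 'rV[C]_d) a : sqmodc (y 0 a) <= sqnorm y.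
Proof.
rewrite /sqnorm (bigD1 a) //= lerDl.
by apply: sumr_ge0 => b _; exact: sqmodc_ge0.
Qed.

Lemma sqnorm_gt0 d (y : 'rV[C]_d) : (0 < sqnorm y) = (y != 0).
Proof.
apply/idP/idP.
  apply: contraTneq => ->; rewrite -leNgt /sqnorm big1 // => a _.
  by rewrite mxE sqmodc0.
move=> /eqP y0; rewrite lt_def sqnorm_ge0 andbT; apply/eqP => h; apply: y0.
apply/rowP => a; rewrite mxE; apply/eqP.
by rewrite -sqmodc_eq0 eq_le sqmodc_ge0 andbT -h sqmodc_le_sqnorm.
Qed.

(** A weak Hadamard inequality: in the Leibniz expansion every entry is bounded by the norm of its
    row, and the constant absorbs the number of permutations. *)
Lemma sqmodc_det_le d :
  exists2 K : R, 0 < K &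
    forall A : 'M[C]_d, sqmodc (\det A) <= K * \prod_i sqnorm (row i A).
Proof.
exists (2 ^+ #|'S_d| * #|'S_d|%:R) => [|A].
  rewrite mulr_gt0 ?exprn_gt0 // ltr0n; apply/card_gt0P; by exists 1%g.
apply: le_trans (sqmodc_sum_le _ _) _.
have -> : size (index_enum 'S_d) = #|'S_d|.
  by rewrite -sum1_card -sum1_size; apply: eq_bigl => s; rewrite inE.
rewrite -mulrA ler_pM2l ?exprn_gt0 //.
have -> : #|'S_d|%:R * \prod_i sqnorm (row i A) =
    \sum_(s : 'S_d) \prod_i sqnorm (row i A).
  by rewrite sumr_const mulr_natl.
apply: ler_sum => s _; rewrite sqmodcM sqmodc_sign mul1r sqmodc_prod.
apply: ler_prod => i _; rewrite sqmodc_ge0 /=.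
by have := sqmodc_le_sqnorm (row i A) (s i); rewrite mxE.
Qed.

End SquaredModulus.

(** * Bases of minimal weight chosen among given vectors *)

Section MinimalBasis.
Variables (F : fieldType) (R : realDomainType) (d : nat) (I : finType).
Variable w : I -> 'rV[F]_d.

Definition basis_mx (b : {ffun 'I_d -> I}) : 'M[F]_d := \matrix_k w (b k).

Lemma exists_basis : (forall U : 'M[F]_d, (forall i, (w i <= U)%MS) -> \rank U = d) ->
  exists b, basis_mx b \in unitmx.
Proof.
move=> hfull; pose W := \matrix_(k < #|I|) w (enum_val k).
have hW : row_full W.
  rewrite /row_full -mxrank_gen hfull // => i.
  rewrite genmxE -(enum_rankK i); set k := enum_rank i.
  have -> : w (enum_val k) = row k W by rewrite rowK.
  exact: row_sub.
exists [ffun k => enum_val (fullrankfun hW k)].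
rewrite -row_full_unit.
have -> : basis_mx [ffun k => enum_val (fullrankfun hW k)] =
  rowsub (fullrankfun hW) W.
  by apply/row_matrixP => k; rewrite rowK row_rowsub rowK ffunE.
exact: fullrowsub_full.
Qed.

(* Take a basis of minimal total weight: if [w i] involves the basis vector [k],
   exchanging the two gives another basis. *)
Lemma exists_minimal_basis (x : I -> R) :
    (exists b, basis_mx b \in unitmx) ->
  exists2 b, basis_mx b \in unitmx &
    forall i k, (w i *m invmx (basis_mx b)) 0 k != 0 -> x (b k) <= x i.
Proof.
case=> b0 hb0.
have [b hb hmin] :=
  @Order.TotalTheory.arg_minP _ R _ b0 (fun b => basis_mx b \in unitmx)
    (fun b => \sum_k x (b k)) hb0.
exists b => // i k hik.
pose c := w i *m invmx (basis_mx b).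
have hc : w i = \sum_l c 0 l *: w (b l).
  rewrite -[LHS](mulmxKV hb) mulmx_sum_row; apply: eq_bigr => l _.
  by rewrite rowK.
pose b' := [ffun l => if l == k then i else b l].
have hb' : basis_mx b' \in unitmx.
  rewrite -row_full_unit -sub1mx.
  have h1 : (1%:M <= basis_mx b)%MS by rewrite sub1mx row_full_unit.
  apply: (submx_trans h1).
  apply/row_subP => l; rewrite rowK.
  have hl j : j != k -> (w (b j) <= basis_mx b')%MS.
    move=> hj; have -> : w (b j) = row j (basis_mx b').
      by rewrite rowK ffunE (negPf hj).
    exact: row_sub.
  have [->|/hl //] := eqVneq l k.
  have hi : (w i <= basis_mx b')%MS.
    have -> : w i = row k (basis_mx b') by rewrite rowK ffunE eqxx.
    exact: row_sub.
  have : (c 0 k *: w (b k) <= basis_mx b')%MS.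
    have -> : c 0 k *: w (b k) = w i - \sum_(l | l != k) c 0 l *: w (b l).
      by rewrite {1}hc (bigD1 k) //= addrK.
    rewrite addmx_sub // eqmx_opp summx_sub // => j hj.
    by rewrite scalemx_sub // hl.
  by rewrite (eqmx_scale _ hik).
have := hmin _ hb'; rewrite (bigD1 k) // [leRHS](bigD1 k) //= !ffunE eqxx.
rewrite [X in _ <= _ + X](eq_bigr (fun l => x (b l))) ?lerD2r // => l hl.
by rewrite ffunE (negPf hl).
Qed.

End MinimalBasis.

(** * The potential of an invertible matrix and its boundedness *)

Lemma ln_prod (R : realType) (I : finType) (x : I -> R) :
  (forall i, 0 < x i) -> ln (\prod_i x i) = \sum_i ln (x i).
Proof.
move=> x0; suff [] : 0 < \prod_i x i /\ ln (\prod_i x i) = \sum_i ln (x i) by [].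
apply: (big_ind2 (fun p s : R => 0 < p /\ ln p = s)) => [|p s q t [p0 <-] [q0 <-]|i _].
- by rewrite ln1.
- by rewrite mulr_gt0 // lnM // posrE.
- by rewrite x0.
Qed.

Section Potential.
Variables (R : realType) (d : nat) (I : finType) (w : I -> 'rV[R[i]]_d).

(** The weights [#|I|] and [d] make this invariant under scaling of [T]. Maximising it amounts to
    putting the vectors in radial isotropic position. *)
Definition potential (T : 'M[R[i]]_d) : R :=
  #|I|%:R * ln (sqmodc (\det T)) - d%:R * \sum_i ln (sqnorm (w i *m T)).

(** The semistability condition: a subspace of dimension [r] contains at most the fraction [r / d]
    of the vectors. *)
Definition well_spread : Prop :=
  forall U : 'M[R[i]]_d, (d * #|[set i | (w i <= U)%MS]| <= #|I| * \rank U)%N.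

Hypotheses (d_gt0 : (0 < d)%N) (I_gt0 : (0 < #|I|)%N) (hw : well_spread).

Lemma well_spread_neq0 i : w i != 0.
Proof.
apply/negP => /eqP wi0; have := hw 0; rewrite mxrank0 muln0 leqn0 muln_eq0.
rewrite -leqn0 leqNgt d_gt0 /= cards_eq0 => /eqP/setP/(_ i).
by rewrite !inE wi0 sub0mx.
Qed.

Lemma sqnorm_transform_gt0 (T : 'M[R[i]]_d) i :
  T \in unitmx -> 0 < sqnorm (w i *m T).
Proof.
move=> hT; rewrite sqnorm_gt0; apply: contra (well_spread_neq0 i) => /eqP h.
by rewrite -[w i](mulmxK hT) h mul0mx.
Qed.

Lemma well_spread_basis : exists b, basis_mx w b \in unitmx.
Proof.
apply: exists_basis => U hU; apply/eqP; rewrite eqn_leq rank_leq_row /=.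
have := hw U; have -> : [set i | (w i <= U)%MS] = [set: I].
  by apply/setP => i; rewrite !inE hU.
by rewrite cardsT mulnC leq_pmul2l.
Qed.

(** A vector of weight at most [t] involves only basis vectors of weight at most [t], hence lies in
    their span. Spreading turns this into an inequality of sublevel counts for every [t], and
    majorization sums these up. *)
Lemma minimal_basis_weight (x : I -> R) (b : {ffun 'I_d -> I}) :
    basis_mx w b \in unitmx ->
    (forall i k, (w i *m invmx (basis_mx w b)) 0 k != 0 -> x (b k) <= x i) ->
  #|I|%:R * \sum_k x (b k) <= d%:R * \sum_i x i.
Proof.
move=> hb hmin.
have := @le_sum_of_sublevel_card R I 'I_d x (fun k => x (b k)).
rewrite card_ord; apply => t.
pose U := (\sum_(k | (x (b k) <= t)%R) <<w (b k)>>)%MS.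
have rU : (\rank U <= #|[pred k | (x (b k) <= t)%R]|)%N.
  rewrite -sum1_card (leq_trans (mxrank_sum_leqif _).1) //=.
  by apply: leq_sum => k _; rewrite mxrank_gen rank_leq_row.
apply: leq_trans (leq_trans (hw U) _); last by rewrite leq_pmul2l.
rewrite leq_pmul2l // subset_leq_card //; apply/fintype.subsetP => i; rewrite !inE => hi.
rewrite -[w i](mulmxKV hb) mulmx_sum_row summx_sub // => k _.
have [->|hk] := eqVneq ((w i *m invmx (basis_mx w b)) 0 k) 0.
  by rewrite scale0r sub0mx.
rewrite scalemx_sub // rowK (sumsmx_sup k) ?genmxE //.
exact: le_trans (hmin _ _ hk) hi.
Qed.

(** The determinant bound for the rows [w (b k) *m T] controls [det T] by the norms along a basis
    [b]. Choosing [b] minimal for the weights [ln |w i T|^2] bounds these norms by the average over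
    all [i]. *)
Lemma potential_bounded :
  exists K, forall T, T \in unitmx -> potential T <= K.
Proof.
have [Kd Kd0 hKd] := sqmodc_det_le R d.
pose K b : R := #|I|%:R * (ln Kd - ln (sqmodc (\det (basis_mx w b)))).
(* The minimal basis depends on [T]; summing over the finitely many [b] makes the bound uniform. *)
exists (\sum_b `|K b|) => T hT.
have x0 i := sqnorm_transform_gt0 i hT.
have [b hb hmin] :=
  exists_minimal_basis (fun i => ln (sqnorm (w i *m T))) well_spread_basis.
apply: (@le_trans _ _ (K b)); last first.
  rewrite (le_trans (ler_norm _)) // (bigD1 b) //= lerDl.
  by rewrite sumr_ge0.
have hsum := minimal_basis_weight hb hmin.
have dT : 0 < sqmodc (\det T) by rewrite sqmodc_gt0 -unitfE -unitmxE.
have dB : 0 < sqmodc (\det (basis_mx w b)) by rewrite sqmodc_gt0 -unitfE -unitmxE.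
have : ln (sqmodc (\det (basis_mx w b *m T))) <=
    ln (Kd * \prod_k sqnorm (w (b k) *m T)).
  rewrite ler_ln ?posrE ?mulr_gt0 ?prodr_gt0 //; last first.
    by rewrite det_mulmx sqmodcM mulr_gt0.
  apply: le_trans (hKd _) _; rewrite ler_pM2l // le_eqVlt; apply/orP; left.
  by apply/eqP; apply: eq_bigr => k _; rewrite row_mul rowK.
rewrite det_mulmx sqmodcM !lnM ?posrE ?prodr_gt0 // ln_prod //.
rewrite -(@ler_pM2l _ #|I|%:R) ?ltr0n // !mulrDr => hln.
by rewrite /potential /K mulrBr; lra.
Qed.

(** The invertible matrices are not compact, so the supremum of the potential is only approached, up
    to [e]. *)
Lemma near_maximal (e : R) : 0 < e ->
  exists2 T, T \in unitmx &
    forall S, S \in unitmx -> potential S <= potential T + e.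
Proof.
move=> e0; have [K hK] := potential_bounded.
pose A : set R := [set potential T | T in [set T | T \in unitmx]]%classic.
have hA : has_sup A.
  split; first by exists (potential 1%:M), 1%:M => //=; exact: unitmx1.
  by exists K => _ [T hT <-]; exact: hK.
have [_ [T hT <-] hlt] := sup_adherent e0 hA.
exists T => // S hS.
have : potential S <= sup A by apply: ub_le_sup; [case: hA|exists S].
by move: hlt; lra.
Qed.

End Potential.

(** * Hermitian products, the moment matrix and the frame potential *)

Section Hermitian.
Variable R : realType.
Local Notation C := R[i].

Definition hdot d (y z : 'rV[C]_d) : C := \sum_a y 0 a * (z 0 a)^*%C.

Lemma sqmodcE (z : C) : (sqmodc z)%:C%C = z * z^*%C.
Proof.
by case: z => a b; rewrite /sqmodc; simpc; congr (_ +i* _)%C => /=; ring.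
Qed.

Lemma hdotD d (y1 y2 z : 'rV[C]_d) : hdot (y1 + y2) z = hdot y1 z + hdot y2 z.
Proof. by rewrite -big_split /=; apply: eq_bigr => a _; rewrite mxE mulrDl. Qed.

Lemma hdotZ d c (y z : 'rV[C]_d) : hdot (c *: y) z = c * hdot y z.
Proof. by rewrite mulr_sumr; apply: eq_bigr => a _; rewrite mxE mulrA. Qed.

Lemma hdotC d (y z : 'rV[C]_d) : hdot y z = (hdot z y)^*%C.
Proof.
rewrite rmorph_sum; apply: eq_bigr => a _.
by rewrite rmorphM /= conjcK mulrC.
Qed.

Lemma hdotDr d (y z1 z2 : 'rV[C]_d) : hdot y (z1 + z2) = hdot y z1 + hdot y z2.
Proof. by rewrite hdotC hdotD rmorphD /= -!hdotC. Qed.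

Lemma hdotZr d c (y z : 'rV[C]_d) : hdot y (c *: z) = c^*%C * hdot y z.
Proof. by rewrite hdotC hdotZ rmorphM /= -hdotC. Qed.

Lemma hdot_sqnorm d (y : 'rV[C]_d) : hdot y y = (sqnorm y)%:C%C.
Proof.
by rewrite /sqnorm rmorph_sum; apply: eq_bigr => a _ /=; rewrite sqmodcE.
Qed.

(** The squared cosine of the angle between the complex lines spanned by [y] and [z]; the quotient
    makes it independent of their lengths. *)
Definition coherence d (y z : 'rV[C]_d) : R :=
  sqmodc (hdot y z) / (sqnorm y * sqnorm z).

Lemma coherence_ge0 d (y z : 'rV[C]_d) : 0 <= coherence y z.
Proof. by rewrite divr_ge0 ?mulr_ge0 ?sqmodc_ge0 ?sqnorm_ge0. Qed.

Lemma coherence_refl d (y : 'rV[C]_d) : y != 0 -> coherence y y = 1.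
Proof.
rewrite -sqnorm_gt0 => y0; rewrite /coherence hdot_sqnorm /sqmodc /= expr0n addr0.
by rewrite -expr2 divff // sqrf_eq0 gt_eqF.
Qed.

Section Moment.
Variables (d : nat) (I : finType) (P : pred I) (y : I -> 'rV[C]_d).

(** Up to transposition, an entry of the sum of the orthogonal projections onto the lines spanned by
    the [y i]. Isotropy means that this sum is a scalar matrix. *)
Definition moment a b : C :=
  \sum_(i | P i) y i 0 a * (y i 0 b)^*%C * ((sqnorm (y i))^-1)%:C%C.

(** The frame potential of the normalised vectors. *)
Definition energy : R :=
  \sum_(i | P i) \sum_(j | P j) coherence (y i) (y j).

(** The Gram matrix and the moment matrix of the normalised vectors have the same Hilbert-Schmidt
    norm: both squares expand into the same fourfold sum. *)
Lemma energyE : energy = \sum_a \sum_b sqmodc (moment a b).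
Proof.
apply: complexI; rewrite !rmorph_sum /=.
pose t i j a b := (y i 0 a * (y i 0 b)^*%C * ((sqnorm (y i))^-1)%:C%C) *
  ((y j 0 a)^*%C * (y j 0 b) * ((sqnorm (y j))^-1)%:C%C).
transitivity (\sum_(i | P i) \sum_(j | P j) \sum_a \sum_b t i j a b).
  apply: eq_bigr => i _; rewrite rmorph_sum; apply: eq_bigr => j _ /=.
  rewrite /coherence rmorphM /= invfM rmorphM /= sqmodcE [in X in _ * X * _]/hdot rmorph_sum.
  rewrite big_distrlr /= mulr_suml; apply: eq_bigr => a _.
  rewrite mulr_suml; apply: eq_bigr => b _.
  by rewrite /t rmorphM /= conjcK; ring.
transitivity (\sum_a \sum_b \sum_(i | P i) \sum_(j | P j) t i j a b); last first.
  apply: eq_bigr => a _; rewrite rmorph_sum; apply: eq_bigr => b _ /=.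
  rewrite sqmodcE [in X in _ * X]/moment rmorph_sum big_distrlr /=.
  apply: eq_bigr => i _; apply: eq_bigr => j _.
  rewrite /t !rmorphM /= conjcK; congr (_ * (_ * _)).
  by simpc.
under eq_bigr => i _ do rewrite exchange_big.
under eq_bigr => i _ do under eq_bigr => a _ do rewrite exchange_big.
rewrite exchange_big; apply: eq_bigr => a _.
by rewrite exchange_big.
Qed.

Definition moment_diag a : R :=
  \sum_(i | P i) sqmodc (y i 0 a) / sqnorm (y i).

Lemma moment_diagE a : moment a a = (moment_diag a)%:C%C.
Proof.
rewrite rmorph_sum; apply: eq_bigr => i _.
by rewrite rmorphM /= sqmodcE.
Qed.

Hypotheses (d_gt0 : (0 < d)%N) (y_neq0 : forall i, P i -> y i != 0).

Lemma sum_moment_diag : \sum_a moment_diag a = #|P|%:R.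
Proof.
rewrite exchange_big /= (eq_bigr (fun=> 1)) ?sumr_const // => i Pi.
by rewrite -mulr_suml divff // gt_eqF // sqnorm_gt0 y_neq0.
Qed.

Lemma moment_diag_ge0 a : 0 <= moment_diag a.
Proof. by apply: sumr_ge0 => i _; rewrite divr_ge0 ?sqmodc_ge0 ?sqnorm_ge0. Qed.

Lemma moment_diag_le a : moment_diag a <= #|P|%:R.
Proof.
rewrite -sum_moment_diag (bigD1 a) //= lerDl.
by apply: sumr_ge0 => b _; exact: moment_diag_ge0.
Qed.

(** Pythagoras for the moment matrix: its trace is [#|P|], so its projection onto the scalar
    matrices is [#|P| / d] times the identity, of squared norm [#|P|^2 / d]. *)
Lemma energy_deviation :
  energy = #|P|%:R ^+ 2 / d%:R +
    \sum_a \sum_b sqmodc (moment a b - (#|P|%:R / d%:R *+ (a == b))%:C%C).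
Proof.
have d0 : d%:R != 0 :> R by rewrite pnatr_eq0 -lt0n.
set mu : R := #|P|%:R / d%:R.
have h a b : sqmodc (moment a b - (mu *+ (a == b))%:C%C) =
    sqmodc (moment a b) + (mu ^+ 2 - 2 * mu * moment_diag a) *+ (a == b).
  have [<-|_] := eqVneq a b; last by rewrite !mulr0n rmorph0 subr0 addr0.
  by rewrite moment_diagE -rmorphB /= /sqmodc /= !mulr1n; ring.
have hs a (c : R) : \sum_(b < d) c *+ (a == b) = c.
  rewrite (bigD1 a) //= eqxx mulr1n big1 ?addr0 // => b /negPf hb.
  by rewrite eq_sym hb mulr0n.
rewrite energyE.
under [X in _ = _ + X]eq_bigr => a _.
  under eq_bigr => b _ do rewrite h.
  rewrite big_split /= hs.
  over.
rewrite big_split /= sumrB -[\sum_(i < d) 2 * mu * _]mulr_sumr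
  sum_moment_diag sumr_const card_ord.
rewrite -mulr_natl /mu; field.
exact: d0.
Qed.

(** The Welch bound. *)
Lemma energy_ge : #|P|%:R ^+ 2 / d%:R <= energy.
Proof.
rewrite energy_deviation lerDl.
by do 2!apply: sumr_ge0 => ? _; exact: sqmodc_ge0.
Qed.

End Moment.
End Hermitian.

(** * The Welch bound inside a two-dimensional subspace *)

Section Rank2.
Variables (R : realType) (d : nat).
Local Notation C := R[i].

Lemma conjcM (a b : C) : (a * b)^*%C = a^*%C * b^*%C.
Proof. exact: rmorphM. Qed.

(* Orthogonalise the two rows of [U] to move the vectors isometrically to [C^2]. *)
Lemma isometry_rank2 (U : 'M[C]_(2, d)) : exists f : 'rV[C]_d -> 'rV[C]_2,
  forall y z, (y <= U)%MS -> (z <= U)%MS -> hdot (f y) (f z) = hdot y z.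
Proof.
pose p := row 0 U; pose q := row 1 U.
pose c := hdot q p / hdot p p; pose r := q - c *: p.
have hrp : hdot r p = 0.
  rewrite /r hdotD -scaleNr hdotZ /c.
  have [p0|p0] := eqVneq p 0.
    have hz (v : 'rV[C]_d) : hdot v 0 = 0.
      by rewrite /hdot big1 // => a _; rewrite mxE rmorph0 mulr0.
    by rewrite p0 !hz mulr0 addr0.
  by rewrite mulNr divfK ?subrr // hdot_sqnorm fmorph_eq0 gt_eqF // sqnorm_gt0.
have hpr : hdot p r = 0 by rewrite hdotC hrp rmorph0.
pose al (y : 'rV[C]_d) k := (y *m pinvmx U) 0 k.
have hy y : (y <= U)%MS -> y = (al y 0 + al y 1 * c) *: p + al y 1 *: r.
  move=> yU; rewrite -{1}(mulmxKpV yU) mulmx_sum_row big_ord_recl big_ord1.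
  rewrite -/(al y 0) -/p.
  have -> : lift ord0 ord0 = 1 :> 'I_2 by apply/val_inj.
  rewrite -/(al y 1) -/q /r scalerBr scalerDl scalerA.
  by rewrite -addrA; congr (_ + _); rewrite addrC subrK.
pose sp : C := (Num.sqrt (sqnorm p))%:C%C.
pose sr : C := (Num.sqrt (sqnorm r))%:C%C.
have hsq (v : 'rV[C]_d) :
    (Num.sqrt (sqnorm v))%:C%C * (Num.sqrt (sqnorm v))%:C%C = hdot v v.
  by rewrite hdot_sqnorm -rmorphM /= -expr2 sqr_sqrtr // sqnorm_ge0.
(* Coordinates along [p] and [r] are multiplied by the norms of [p] and [r] instead of dividing
   these vectors by them, so that [p] or [r] may vanish. *)
exists (fun y => \row_k (if k == 0 then (al y 0 + al y 1 * c) * sp else al y 1 * sr)).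
move=> y z yU zU; rewrite [in RHS](hy y yU) [in RHS](hy z zU).
rewrite !hdotD !hdotZ !hdotDr !hdotZr hpr hrp !mulr0 add0r addr0 -!hsq.
rewrite /hdot big_ord_recl big_ord1 !mxE /= !conjcM /sp /sr !conjc_real.
by ring.
Qed.

(** The isometry into [C^2] preserves every coherence, so the Welch bound holds with 2 in place of
    [d]. *)
Lemma energy_ge_rank2 (I : finType) (P : pred I) (y : I -> 'rV[C]_d)
    (U : 'M[C]_(2, d)) :
    (forall i, P i -> (y i <= U)%MS) -> (forall i, P i -> y i != 0) ->
  #|P|%:R ^+ 2 / 2 <= energy P y.
Proof.
move=> yU y0; have [f hf] := isometry_rank2 U.
have hn i : P i -> sqnorm (f (y i)) = sqnorm (y i).
  by move=> Pi; apply: complexI; rewrite -!hdot_sqnorm hf ?yU.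
have -> : energy P y = energy P (fun i => f (y i)).
  apply: eq_bigr => i Pi; apply: eq_bigr => j Pj.
  by rewrite /coherence !hn // hf ?yU.
by apply: energy_ge => // i Pi; rewrite -sqnorm_gt0 hn // sqnorm_gt0 y0.
Qed.

End Rank2.

(** * Effect of elementary matrices on norms *)

Section Perturbation.
Variables (R : realType) (d : nat) (I : finType).
Local Notation C := R[i].

(* For [a = b] this dilates a coordinate; letting [a], [b] and [z] vary, these
   matrices probe every entry of the moment matrix. *)
Definition shear (z : C) (a b : 'I_d) : 'M[C]_d := 1%:M + z *: delta_mx a b.

Lemma det_shear z a b : \det (shear z a b) = 1 + z *+ (a == b).
Proof.
wlog hab : a b / (b <= a)%N.
  move=> H; have [/H //|/ltnW/H h] := leqP b a.
  rewrite -det_tr [(shear _ _ _)^T]linearD /= trmx1 linearZ /= trmx_delta.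
  by rewrite h eq_sym.
rewrite det_trig; last first.
  apply/is_trig_mxP => i j hij; rewrite !mxE.
  have -> : (i == j) = false by apply/eqP => h; rewrite h ltnn in hij.
  have [hi|_] := eqVneq i a; last by rewrite mulr0 addr0.
  have [hj|_] := eqVneq j b; last by rewrite mulr0 addr0.
  by rewrite hj hi in hij; exfalso; lia.
rewrite (bigD1 a) //= big1 => [|i /negPf hi]; rewrite !mxE !eqxx.
  by rewrite mulr1 /= mulr_natr.
by rewrite hi mulr0 addr0.
Qed.

Lemma sqnorm_shear z a b (y : 'rV[C]_d) :
  sqnorm (y *m shear z a b) =
  sqnorm y + 2 * complex.Re (z * (y 0 a * (y 0 b)^*%C)) + sqmodc z * sqmodc (y 0 a).
Proof.
have h c : (y *m shear z a b) 0 c = y 0 c + (z * y 0 a) *+ (c == b).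
  rewrite mulmxDr mulmx1 mxE -scalemxAr mxE; congr (_ + _).
  rewrite mxE (bigD1 a) //= big1 => [|i /negPf hi]; rewrite !mxE ?eqxx /=.
    by rewrite addr0 mulrA mulr_natr.
  by rewrite hi mulr0.
rewrite /sqnorm (bigD1 b) //= [X in _ = X + _ + _](bigD1 b) //= h eqxx mulr1n.
rewrite (eq_bigr (fun c => sqmodc (y 0 c))) => [|c /negPf hc]; last first.
  by rewrite h hc addr0.
case: z {h} => z1 z2; case: (y 0 a) => a1 a2; case: (y 0 b) => b1 b2.
by rewrite /sqmodc /=; ring.
Qed.

(** The term linear in [z] isolates the entry [moment a b], which is how near-maximality will
    control that entry. *)
Lemma sum_sqnorm_shear z a b (y : I -> 'rV[C]_d) : (forall i, y i != 0) ->
  \sum_i sqnorm (y i *m shear z a b) / sqnorm (y i) =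
  #|I|%:R + 2 * complex.Re (z * moment predT y a b)
    + sqmodc z * moment_diag predT y a.
Proof.
move=> y0.
have -> : complex.Re (z * moment predT y a b) =
    \sum_i complex.Re (z * (y i 0 a * (y i 0 b)^*%C)) / sqnorm (y i).
  rewrite mulr_sumr (raddf_sum (@complex.Re R : Rcomplex R -> R)) /=.
  apply: eq_bigr => i _; rewrite mulrA.
  by case: (z * _) => u v /=; rewrite mulr0 subr0.
rewrite !mulr_sumr -[#|I|%:R](sumr_const I) -!big_split /=; apply: eq_bigr => i _.
rewrite sqnorm_shear; field.
by rewrite gt_eqF // sqnorm_gt0.
Qed.

End Perturbation.

(** * Near-maximality of the potential forces near-isotropy *)

Section Balancing.
Variables (R : realType) (d : nat) (I : finType) (w : I -> 'rV[R[i]]_d).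
Local Notation C := R[i].
Hypotheses (d_gt0 : (0 < d)%N) (I_gt0 : (0 < #|I|)%N) (hw : well_spread w).

(** The inequality [ln r <= r - 1], applied to the ratio [r] of each squared norm after and before
    [S], replaces the logarithms by a sum that is computable for shears. *)
Lemma potential_mulmx (T S : 'M[C]_d) : T \in unitmx -> S \in unitmx ->
  potential w T + #|I|%:R * ln (sqmodc (\det S)) <=
  potential w (T *m S) +
    d%:R * (\sum_i sqnorm (w i *m T *m S) / sqnorm (w i *m T) - #|I|%:R).
Proof.
move=> hT hS; have hTS : T *m S \in unitmx by rewrite unitmx_mul hT hS.
have dT : 0 < sqmodc (\det T) by rewrite sqmodc_gt0 -unitfE -unitmxE.
have dS : 0 < sqmodc (\det S) by rewrite sqmodc_gt0 -unitfE -unitmxE.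
rewrite /potential det_mulmx sqmodcM lnM ?posrE //.
have : \sum_i ln (sqnorm (w i *m (T *m S))) - \sum_i ln (sqnorm (w i *m T)) <=
    \sum_i sqnorm (w i *m T *m S) / sqnorm (w i *m T) - #|I|%:R.
  rewrite -[#|I|%:R](sumr_const I) -!sumrB; apply: ler_sum => i _.
  have x0 := sqnorm_transform_gt0 d_gt0 hw i hT.
  have z0 := sqnorm_transform_gt0 d_gt0 hw i hTS.
  rewrite mulmxA in z0 *; rewrite -ln_div ?posrE //.
  set r := _ / _; have r0 : 0 < r by rewrite divr_gt0.
  have := @le_ln1Dx _ (r - 1); rewrite [1 + _]addrC subrK; apply.
  by rewrite ltrBDr addrC subrr.
by move=> h; have := ler_wpM2l (ler0n R d) h; lra.
Qed.

Section NearMax.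
Variables (e : R) (T : 'M[C]_d).
Hypotheses (hT : T \in unitmx)
  (hmax : forall S, S \in unitmx -> potential w S <= potential w T + e).
Local Notation y := (fun i => w i *m T).
Local Notation n := #|I|.

Lemma transform_neq0 i : w i *m T != 0.
Proof. by rewrite -sqnorm_gt0; exact: (sqnorm_transform_gt0 d_gt0 hw i hT). Qed.

Lemma shear_potential z a b : 1 + z *+ (a == b) != 0 ->
  n%:R * ln (sqmodc (1 + z *+ (a == b))) <=
  e + d%:R * (2 * complex.Re (z * moment predT y a b)
    + sqmodc z * moment_diag predT y a).
Proof.
move=> hz; have hS : shear z a b \in unitmx by rewrite unitmxE det_shear unitfE.
have hTS : T *m shear z a b \in unitmx by rewrite unitmx_mul hT hS.
have := potential_mulmx hT hS; rewrite det_shear.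
rewrite (@sum_sqnorm_shear _ _ _ z a b y transform_neq0).
by have := hmax hTS; lra.
Qed.

Lemma moment_offdiag_le a b : a != b ->
  sqmodc (moment predT y a b) <= e * n%:R / d%:R.
Proof.
move=> hab; set M := moment _ _ a b.
have n0 : 0 < n%:R :> R by rewrite ltr0n.
have d0 : 0 < d%:R :> R by rewrite ltr0n.
(* This [z] makes the linear term [- 2 |M|^2 / n], while the quadratic term is at most [|M|^2 / n]
   because the diagonal moment is at most [n]. *)
have := @shear_potential (- (n%:R^-1)%:C%C * M^*%C) a b.
rewrite (negPf hab) mulr0n addr0 sqmodc1 ln1 mulr0 oner_eq0 => /(_ isT).
have -> : complex.Re (- (n%:R^-1)%:C%C * M^*%C * M) = - (sqmodc M / n%:R).
  by case: M => u v; rewrite /sqmodc /=; ring.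
have -> : sqmodc (- (n%:R^-1)%:C%C * M^*%C) = sqmodc M / n%:R ^+ 2.
  by case: M => u v; rewrite /sqmodc /= -exprVn; ring.
have hm := moment_diag_le (fun i (_ : predT i) => transform_neq0 i) a.
have : sqmodc M / n%:R ^+ 2 * moment_diag predT y a <= sqmodc M / n%:R.
  rewrite expr2 invfM -!mulrA ler_wpM2l ?sqmodc_ge0 //.
  by apply: ler_piMr; [rewrite invr_ge0 ltW|rewrite ler_pdivrMl // mulr1].
set q := sqmodc M / n%:R => h1 h2.
have : d%:R * q <= e.
  suff : d%:R * q <= e + d%:R * (2 * - q + q) + d%:R * q by lra.
  rewrite lerDr; apply: le_trans h2 _; rewrite lerD2l ler_pM2l //.
  by rewrite lerD2l.
rewrite -ler_pdivlMl // mulrC => hq.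
by rewrite mulrAC -ler_pdivrMr.
Qed.

Lemma moment_diag_dev_le a :
  (moment_diag predT y a - n%:R / d%:R) ^+ 2 <= e * (n * (4 + d.*2))%:R / d%:R ^+ 2.
Proof.
have n0 : 0 < n%:R :> R by rewrite ltr0n.
have d0 : 0 < d%:R :> R by rewrite ltr0n.
set m := moment_diag _ _ a.
have m0 : 0 <= m by exact: moment_diag_ge0.
have mn : m <= n%:R := moment_diag_le (fun i (_ : predT i) => transform_neq0 i) a.
(* The choice [s = x / c] gives [|s| <= 1/2], and [c] is at least the second-order cost [4n + dn].
   The linear gain [2 s x = 2 c s^2] then leaves [c s^2 <= e]. *)
pose c : R := (n * (4 + d.*2))%:R.
have c0 : 0 < c by rewrite ltr0n muln_gt0 I_gt0.
have cE : c = n%:R * (4 + 2 * d%:R) by rewrite /c natrM natrD -mul2n natrM.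
pose x := n%:R - d%:R * m; pose s := x / c.
have d1 : 1 <= d%:R :> R by rewrite ler1n.
have hxc : x = c * s by rewrite /s mulrC divfK ?gt_eqF.
have hs : -(1 / 2) <= s <= 1 / 2.
  rewrite ler_pdivlMr // ler_pdivrMr // /x cE; apply/andP; split; nra.
have s1 : 0 < 1 + s by case/andP: hs => *; lra.
have := @shear_potential s%:C%C a a.
rewrite eqxx mulr1n moment_diagE -/m.
have -> : 1 + s%:C%C = (1 + s)%:C%C by rewrite rmorphD.
rewrite fmorph_eq0 (gt_eqF s1) => /(_ isT).
have -> : sqmodc (1 + s)%:C%C = (1 + s) * (1 + s) by rewrite /sqmodc /=; ring.
have -> : complex.Re (s%:C%C * m%:C%C) = s * m by rewrite /=; ring.
have -> : sqmodc s%:C%C = s ^+ 2 by rewrite /sqmodc /=; ring.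
rewrite lnM ?posrE //.
(* From [ln r <= r - 1] at [r = (1 + s)^-1] comes [ln (1 + s) >= s / (1 + s)], which dominates
   [s - 2 s^2] because [s >= - 1/2]. *)
have hln : s - 2 * s ^+ 2 <= ln (1 + s).
  have h : ln (1 + s)^-1 <= (1 + s)^-1 - 1.
    have := @le_ln1Dx _ ((1 + s)^-1 - 1); rewrite [1 + (_ - _)]addrC subrK; apply.
    by rewrite ltrBDr addrC subrr invr_gt0.
  rewrite lnV ?posrE // in h.
  have : s - 2 * s ^+ 2 <= 1 - (1 + s)^-1; last by lra.
  have -> : 1 - (1 + s)^-1 = s / (1 + s) by field; rewrite gt_eqF.
  by rewrite ler_pdivlMr //; case/andP: hs => *; nra.
move=> hpot.
have hx : c * s ^+ 2 <= e.
  have h1 : n%:R * (s - 2 * s ^+ 2) <= n%:R * ln (1 + s) by rewrite ler_pM2l.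
  have h2 : d%:R * (s ^+ 2 * m) <= d%:R * (s ^+ 2 * n%:R).
    by rewrite ler_pM2l // ler_wpM2l // sqr_ge0.
  have h3 : s * x = c * s ^+ 2 by rewrite hxc; ring.
  have h4 : s * x = s * n%:R - d%:R * (s * m) by rewrite /x; ring.
  have h5 : 0 <= d%:R * n%:R * s ^+ 2 by rewrite mulr_ge0 ?sqr_ge0 ?mulr_ge0 ?ltW.
  rewrite cE in h3 *; lra.
rewrite -/c.
have -> : (m - n%:R / d%:R) ^+ 2 = c * (c * s ^+ 2) / d%:R ^+ 2.
  have -> : c * (c * s ^+ 2) = x ^+ 2 by rewrite hxc; ring.
  by rewrite /x; field; rewrite gt_eqF.
by rewrite ler_pM2r ?invr_gt0 ?exprn_gt0 // mulrC ler_pM2r.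
Qed.

End NearMax.

Lemma exists_balancing (e : R) : 0 < e ->
  exists2 T, T \in unitmx &
    energy predT (fun i => w i *m T) <= #|I|%:R ^+ 2 / d%:R + e.
Proof.
move=> e0; pose c : R := (#|I| * (4 + d.*2))%:R.
have n0 : 0 < #|I|%:R :> R by rewrite ltr0n.
have d0 : 0 < d%:R :> R by rewrite ltr0n.
have d1 : 1 <= d%:R :> R by rewrite ler1n.
have c0 : 0 < c by rewrite ltr0n muln_gt0 I_gt0.
(* Each of the [d^2] entries of the moment matrix will deviate by at most [e1 * c] in squared
   modulus, for a total of [e]. *)
pose e1 := e / (c * d%:R ^+ 2).
have e10 : 0 < e1 by rewrite divr_gt0 // mulr_gt0 ?exprn_gt0.
have [T hT hmax] := near_maximal d_gt0 I_gt0 hw e10.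
exists T => //.
rewrite (energy_deviation d_gt0) => [|i _]; last exact: transform_neq0.
rewrite cardT -cardE lerD2l.
apply: (@le_trans _ _ (\sum_(a < d) \sum_(b < d) e1 * c)); last first.
  have he : e1 * (c * d%:R ^+ 2) = e.
    by rewrite divfK // gt_eqF // mulr_gt0 ?exprn_gt0.
  have aux (x t z : R) : z * (z * (x * t)) = x * (t * z ^+ 2) by ring.
  rewrite !sumr_const card_ord.
  by rewrite -[_ *+ d *+ d]mulr_natl -[e1 * c *+ d]mulr_natl aux he.
apply: ler_sum => a _; apply: ler_sum => b _.
have [<-|hab] := eqVneq a b.
  rewrite mulr1n moment_diagE -rmorphB /= /sqmodc /= expr0n addr0.
  apply: le_trans (moment_diag_dev_le hT hmax a) _.
  rewrite ler_pdivrMr ?exprn_gt0 //.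
  by apply: ler_peMr; [rewrite ltW // mulr_gt0|exact: exprn_ege1].
rewrite mulr0n rmorph0 subr0.
apply: le_trans (moment_offdiag_le hT hmax hab) _.
rewrite ler_pdivrMr // -[e1 * c * _]mulrA (ler_pM2l e10) /c -natrM ler_nat.
by rewrite -mulnA leq_pmulr // muln_gt0 d_gt0.
Qed.

End Balancing.

(** * Counting ordered pairs on ordinary lines *)

Lemma sum_offdiag (R : zmodType) (I : finType) (P : pred I) (f : I -> I -> R) :
  \sum_(p : I * I | [&& P p.1, P p.2 & p.1 != p.2]) f p.1 p.2 =
  \sum_(i | P i) \sum_(j | P j) f i j - \sum_(i | P i) f i i.
Proof.
rewrite -(pair_big_dep P (fun i j => P j && (i != j)) f) /= -sumrB.
apply: eq_bigr => i Pi; rewrite [X in _ = X - _](bigD1 i) //= [X in _ = X - _]addrC addrK.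
by apply: eq_bigl => j; rewrite eq_sym.
Qed.

Section LineCount.
Variables (R : realType) (d : nat) (I : finType) (w : I -> 'rV[R[i]]_d).
Variable L : I -> I -> {set I}.
Hypotheses (d_gt0 : (0 < d)%N) (I_gt0 : (0 < #|I|)%N) (hw : well_spread w).
Hypothesis L_mem : forall i j, (i \in L i j) && (j \in L i j).
Hypothesis L_eq : forall i j k l,
  i != j -> k != l -> k \in L i j -> l \in L i j -> L k l = L i j.
Hypothesis L_span : forall i j k, k \in L i j -> (w k <= col_mx (w i) (w j))%MS.

(** Any two indices of a line determine it, so the pairs with line [l] are all the pairs of distinct
    elements of [l]. With [r = #|l|], removing the diagonal leaves coherence at least [r^2/2 - r],
    and four times this is at least [r (r - 1)] once [r >= 3]. *)
Lemma line_energy_ge (T : 'M[R[i]]_d) (l : {set I}) : T \in unitmx ->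
  \sum_(p : I * I | (p.1 != p.2) && (L p.1 p.2 == l)) (#|l| != 2)%:R <=
  4 * \sum_(p : I * I | (p.1 != p.2) && (L p.1 p.2 == l))
    coherence (w p.1 *m T) (w p.2 *m T).
Proof.
move=> hT; pose g i j := coherence (w i *m T) (w j *m T).
have y0 i : w i *m T != 0.
  by rewrite -sqnorm_gt0; exact: (sqnorm_transform_gt0 d_gt0 hw i hT).
have g1 i : g i i = 1 by exact: coherence_refl.
have [[[i j] /andP[/= hij /eqP hl]]|hno] :=
  pselect (exists p : I * I, (p.1 != p.2) && (L p.1 p.2 == l)); last first.
  rewrite !big_pred0 ?mulr0 // => p; apply/negP => hp; apply: hno; by exists p.
have [_|hl2] := eqVneq #|l| 2%N.
  rewrite /= big1 // mulr_ge0 // sumr_ge0 // => p _; exact: coherence_ge0.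
have fib : (fun p : I * I => (p.1 != p.2) && (L p.1 p.2 == l)) =1
    (fun p => [&& p.1 \in l, p.2 \in l & p.1 != p.2]).
  move=> [k m] /=; have [_|hkm] := eqVneq k m; first by rewrite !andbF.
  rewrite andbT; apply/eqP/andP => [<-|[hk hm]]; first exact/andP/L_mem.
  by rewrite -hl; rewrite -hl in hk hm; exact: L_eq.
rewrite !(eq_bigl _ _ fib) (sum_offdiag (mem l) g).
rewrite (sum_offdiag (mem l) (fun _ _ => 1)).
rewrite (eq_bigr _ (fun i _ => g1 i)) !sumr_const /=.
rewrite -(mulr_natl #|l|%:R).
have E2 : #|l|%:R ^+ 2 / 2 <= \sum_(i0 in l) \sum_(j0 in l) g i0 j0.
  apply: (@energy_ge_rank2 _ _ _ (mem l) (fun i => w i *m T)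
    (col_mx (w i) (w j) *m T)) => // k hk.
  by rewrite submxMr // L_span // hl.
have l3 : (3 <= #|l|)%N.
  have : (1 < #|l|)%N.
    have /andP[hi hj] := L_mem i j; rewrite hl in hi hj.
    by apply/card_gt1P; exists i, j.
  lia.
have : 3 <= #|l|%:R :> R by rewrite (ler_nat R 3).
move: E2; set r := #|l|%:R; set S := \sum_(_ in _) _ => *; nra.
Qed.

(** Summing over lines gives [n^2 - n - D <= 4 (energy - n)]. Balancing up to [e / 4] bounds the
    right side by [n^2 - 4n + e], so [D >= 3n - e] for every positive [e]. *)
Lemma ordinary_pairs_ge : d = 4 ->
  (3 * #|I| <= #|[set p : I * I | (p.1 != p.2) && (#|L p.1 p.2| == 2)]|)%N.
Proof.
move=> d4; set D := #|[set p | _]|; rewrite -(ler_nat R) natrM.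
apply/ler_addgt0Pr => e e0.
have [T hT hen] := exists_balancing d_gt0 I_gt0 hw (divr_gt0 e0 (ltr0n R 4)).
pose g i j := coherence (w i *m T) (w j *m T).
have g1 i : g i i = 1.
  apply: coherence_refl.
  by rewrite -sqnorm_gt0; exact: (sqnorm_transform_gt0 d_gt0 hw i hT).
have hcount : \sum_(p : I * I | p.1 != p.2) (#|L p.1 p.2| != 2)%:R <=
    4 * \sum_(p : I * I | p.1 != p.2) g p.1 p.2.
  rewrite !(partition_big (fun p : I * I => L p.1 p.2) predT) //= mulr_sumr.
  apply: ler_sum => l _; apply: le_trans (line_energy_ge l hT).
  by apply: ler_sum => p /andP[_ /eqP ->].
have hg := sum_offdiag predT g; have h1 := sum_offdiag predT (fun _ _ : I => 1 : R).
rewrite /= in hg h1.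
rewrite hg (eq_bigr _ (fun i _ => g1 i)) !sumr_const in hcount.
have hD : \sum_(p : I * I | p.1 != p.2) (#|L p.1 p.2| != 2)%:R =
    \sum_(p : I * I | p.1 != p.2) 1 - D%:R :> R.
  rewrite /D -sum1_card natr_sum.
  have -> : \sum_(p in [set p : I * I | (p.1 != p.2) && (#|L p.1 p.2| == 2)]) 1%:R =
      \sum_(p : I * I | p.1 != p.2) (#|L p.1 p.2| == 2)%:R :> R.
    by rewrite big_mkcond [RHS]big_mkcond; apply: eq_bigr => p _;
       rewrite inE; case: (_ != _); case: (_ == _).
  rewrite -sumrB; apply: eq_bigr => p _.
  by case: (_ == _); rewrite ?subr0 ?subrr.
rewrite hD h1 !sumr_const -(mulr_natl #|I|%:R) in hcount.
have hE : energy predT (fun i => w i *m T) = \sum_i \sum_j g i j by [].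
rewrite hE d4 in hen.
by move: hen hcount; rewrite -mulr_natl; nra.
Qed.

End LineCount.

(** * Affine lines and the finite sets they cut out *)

Section AffineLines.
Variables (F : fieldType) (d : nat).
Implicit Types (x y z : 'rV[F]_d) (V : {fset 'rV[F]_d}).

Definition affine_line x y : set 'rV[F]_d := [set z | (z - x <= y - x)%MS]%classic.

Lemma is_line_affine_line x y : x != y -> is_line (affine_line x y).
Proof.
move=> hxy; exists x, (y - x); split=> //.
by rewrite /row_free rank_rV subr_eq0 [y == x]eq_sym hxy.
Qed.

Lemma affine_line_l x y : affine_line x y x.
Proof. by rewrite /affine_line /= subrr sub0mx. Qed.

Lemma affine_line_r x y : affine_line x y y.
Proof. by rewrite /affine_line /= submx_refl. Qed.

Lemma line_through (L : set 'rV[F]_d) x y :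
  is_line L -> L x -> L y -> x != y -> L = affine_line x y.
Proof.
case=> p [M [_ ->]] /= hx hy hxy.
have hyx : (y - x :=: M)%MS.
  have /sub_rVP[c hc] : (y - x <= M)%MS.
    by rewrite -(subrKA p) -[p - x]opprB addmx_sub // eqmx_opp.
  rewrite hc; apply: eqmx_scale; apply: contraNneq hxy => c0.
  by rewrite eq_sym -subr_eq0 hc c0 scale0r.
apply/seteqP; split=> z /= hz; rewrite /affine_line /= hyx in hz *.
  by rewrite -(subrKA p) -[p - x]opprB addmx_sub // eqmx_opp.
by rewrite -(subrKA x) addmx_sub.
Qed.

Lemma affine_line_eq x y u v : x != y -> u != v ->
  affine_line x y u -> affine_line x y v -> affine_line u v = affine_line x y.
Proof.
by move=> hxy huv hu hv; rewrite -(line_through (is_line_affine_line hxy) hu hv).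
Qed.

Lemma flat_affine_line k (H : set 'rV[F]_d) x y z :
  affine_flat k H -> H x -> H y -> affine_line x y z -> H z.
Proof.
case=> p [M [_ ->]] /= hx hy hz.
rewrite -(subrKA x) addmx_sub // (submx_trans hz) //.
by rewrite -(subrKA p) -[p - x]opprB addmx_sub // eqmx_opp.
Qed.

Section InFset.
Variable V : {fset 'rV[F]_d}.

Definition line_set (i j : V) : {set V} :=
  [set k | (val k - val i <= val j - val i)%MS].

Lemma line_setP i j k : k \in line_set i j <-> affine_line (val i) (val j) (val k).
Proof. by rewrite inE. Qed.

Lemma line_set_mem i j : (i \in line_set i j) && (j \in line_set i j).
Proof.
by apply/andP; split; apply/line_setP; [exact: affine_line_l|exact: affine_line_r].
Qed.

Lemma line_set_eq i j k l : i != j -> k != l ->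
  k \in line_set i j -> l \in line_set i j -> line_set k l = line_set i j.
Proof.
move=> hij hkl /line_setP hk /line_setP hl; apply/setP => m.
have e := affine_line_eq hij hkl hk hl.
by apply/idP/idP => /line_setP h; apply/line_setP; rewrite ?e // -e.
Qed.

Lemma line_set2 i j k l : #|line_set i j| = 2%N -> i != j -> k != l ->
  k \in line_set i j -> l \in line_set i j ->
  (k = i /\ l = j) \/ (k = j /\ l = i).
Proof.
move=> hc hij hkl.
have -> : line_set i j = [set i; j].
  apply/eqP; rewrite eq_sym eqEcard cards2 hij hc leqnn andbT.
  by apply/fintype.subsetP => m /set2P[]->; have /andP[] := line_set_mem i j.
move=> /set2P[]hk /set2P[]hl; rewrite hk hl ?eqxx // in hkl *; by [left|right].
Qed.

Definition trace_set (A : set 'rV[F]_d) : {set V} := [set i | val i \in A].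

Lemma trace_setP A i : reflect (A (val i)) (i \in trace_set A).
Proof. by rewrite inE; apply: (iffP idP) => [/set_mem|/mem_set]. Qed.

Lemma card_points_in (A : set 'rV[F]_d) : #|` points_in V A| = #|trace_set A|.
Proof.
rewrite /points_in cardE -[in RHS](size_map val); apply/perm_size/uniq_perm.
- exact: fset_uniq.
- by rewrite map_inj_uniq ?enum_uniq //; exact: val_inj.
move=> x; apply/idP/mapP => [|[k]]; rewrite ?mem_enum.
  by rewrite in_fset => /andP[hx hA]; exists [` hx]%fset; rewrite // mem_enum inE.
by rewrite inE => hk ->; rewrite in_fset; apply/andP; split=> //; exact: valP.
Qed.

Lemma finite_ordinary_lines : finite_set (ordinary_lines V).
Proof.
apply: (@sub_finite_set _ _
  [set affine_line (val p.1) (val p.2) | p in [set: V * V]]%classic); last first.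
  exact/finite_image/finite_finset.
move=> L [hL]; rewrite card_points_in => /eqP; rewrite eqn_leq => /andP[_].
move=> /card_gt1P[i [j [hi hj hij]]]; exists (i, j) => //=.
rewrite !inE in hi hj.
by apply/esym/line_through => //; apply/set_mem.
Qed.

(** Since [E] contains at most one orientation of each pair, mapping a pair to its line is injective
    on [E]. *)
Lemma num_ordinary_lines_ge (E : {set V * V}) :
    (forall i j, (i, j) \in E ->
      [/\ i != j, #|line_set i j| = 2%N & (j, i) \notin E]) ->
  (#|E| <= num_ordinary_lines V)%N.
Proof.
move=> hE; pose f (p : V * V) := affine_line (val p.1) (val p.2).
rewrite cardE -(size_map f); apply: uniq_leq_size.
  rewrite map_inj_in_uniq ?enum_uniq // => -[i j] [k l].
  rewrite !mem_enum => hij hkl hf.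
  have [nij cij sij] := hE _ _ hij; have [nkl _ _] := hE _ _ hkl.
  have hk : k \in line_set i j.
    by apply/line_setP; rewrite -[affine_line _ _]/(f (i, j)) hf; exact: affine_line_l.
  have hl : l \in line_set i j.
    by apply/line_setP; rewrite -[affine_line _ _]/(f (i, j)) hf; exact: affine_line_r.
  have [[-> ->] //|[ek el]] := line_set2 cij nij nkl hk hl.
  by rewrite ek el (negPf sij) in hkl.
move=> L /mapP[[i j]]; rewrite mem_enum => /hE[nij cij _] ->.
rewrite in_fset_set; last exact: finite_ordinary_lines.
apply/mem_set; split; first exact: is_line_affine_line.
rewrite card_points_in; rewrite -[RHS]cij; congr #|pred_of_set _|; apply/setP => k.
by rewrite !inE; apply/idP/idP => [/set_mem|h]; last exact/mem_set.
Qed.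

(** A line through a point [p] off the flat meets it at most once. If the line from [p] to [q] in
    the flat is not ordinary, it contains a third point, again off the flat, and different [q] give
    different third points. So all but at most [#|~: trace_set H| - 1] of these lines are
    ordinary. *)
Lemma num_ordinary_lines_flat k (H : set 'rV[F]_d) : affine_flat k H ->
  (#|~: trace_set H| * (#|trace_set H|.+1 - #|~: trace_set H|) <= num_ordinary_lines V)%N.
Proof.
move=> hH; set A := trace_set H.
pose E := [set p : V * V | [&& p.1 \notin A, p.2 \in A & #|line_set p.1 p.2| == 2%N]].
apply: (@leq_trans #|E|); last first.
  apply: num_ordinary_lines_ge => i j; rewrite inE /= => /and3P[hi hj /eqP hc].
  split=> //; first by apply: contraNneq hi => ->.
  by rewrite inE /= hj.
have noline p q q' : p \notin A -> q \in A -> q' \in A ->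
    ~ affine_line (val q) (val q') (val p).
  move=> hp /trace_setP hq /trace_setP hq' h; move/trace_setP: hp; apply.
  exact: flat_affine_line hH hq hq' h.
have hp p : p \notin A ->
    (#|A|.+1 - #|~: A| <= #|[set q in A | #|line_set p q| == 2%N]|)%N.
  move=> pA; set G := finset _; pose B := A :\: G.
  (* A third point on the line; on [B] the choice succeeds, so the default [p] does not occur
     there. *)
  pose h q := odflt p [pick z in line_set p q | (z != p) && (z != q)].
  have hB q : q \in B ->
      [/\ q \in A, h q \in line_set p q, h q != p & h q != q].
    move=> /setDP[qA hG]; rewrite inE qA /= in hG.
    have npq : p != q by apply: contraNneq pA => ->.
    rewrite /h; case: pickP => [u /and3P[]//|hno]; exfalso.
    move/negP: hG; apply; rewrite -[2%N]/(true.+1) -npq -cards2.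
    apply/eqP; congr #|pred_of_set _|; apply/setP => z; apply/idP/set2P => [hz|[]->]; last first.
    - by have /andP[] := line_set_mem p q.
    - by have /andP[] := line_set_mem p q.
    have := hno z; rewrite hz /=.
    by have [->|_] := eqVneq z p; [left|have [->|] := eqVneq z q; [right|]].
  (* A common third point would merge the two lines through [p], which would then meet the flat
     twice and contain [p] in it. *)
  have hinj : {in B &, injective h}.
    move=> q q' /hB[qA hq n1 n2] /hB[q'A hq' m1 m2] e; apply/eqP; apply/negPn/negP => nqq.
    rewrite -e in hq' m1 m2.
    have npq : p != q by apply: contraNneq pA => ->.
    have npq' : p != q' by apply: contraNneq pA => ->.
    have nph : p != h q by rewrite eq_sym.
    have /andP[pl ql] := line_set_mem p q; have /andP[pl' ql'] := line_set_mem p q'.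
    have e1 := line_set_eq npq nph pl hq; have e2 := line_set_eq npq' nph pl' hq'.
    have hq2 : q' \in line_set p q by rewrite -e1 e2.
    have e3 := line_set_eq npq nqq ql hq2.
    by apply: (noline p q q') => //; apply/line_setP; rewrite e3.
  (* Excluding [p] itself from the possible third points yields the successor in the final bound. *)
  have cB : (#|B| <= #|(~: A) :\ p|)%N.
    rewrite -(card_in_imset hinj) subset_leq_card //.
    apply/fintype.subsetP => _ /imsetP[q hq ->]; have [qA hz n1 n2] := hB _ hq.
    rewrite in_setD1 n1 finset.in_setC /=; apply/negP => zA.
    have npq : p != q by apply: contraNneq pA => ->.
    have /andP[pl ql] := line_set_mem p q.
    have nqz : q != h q by rewrite eq_sym.
    have e := line_set_eq npq nqz ql hz.
    by apply: (noline p q (h q)) => //; apply/line_setP; rewrite e.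
  have : (#|A| = #|G| + #|B|)%N.
    rewrite -(cardsID G A); congr (_ + _)%N; apply: eq_card => z.
    by rewrite !inE; case: (_ \in _).
  have := cardsD1 p (~: A); rewrite finset.in_setC pA /=.
  by move=> -> ->; rewrite add1n subSS leq_subLR addnC leq_add2r.
rewrite -[#|E|]sum1_card.
have -> : (\sum_(p in E) 1 = \sum_(p in ~: A) #|[set q in A | #|line_set p q| == 2%N]|)%N.
  rewrite (eq_bigl (fun p : V * V => (p.1 \in ~: A) &&
    (p.2 \in [set q in A | #|line_set p.1 q| == 2%N]))); last first.
    by move=> p; rewrite !inE.
  rewrite -(pair_big_dep (fun p => p \in ~: A)
    (fun p q => q \in [set q in A | #|line_set p q| == 2%N]) (fun _ _ => 1%N)) /=.
  by apply: eq_bigr => p _; rewrite sum1_card.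
rewrite -sum_nat_const; apply: leq_sum => p; rewrite inE; exact: hp.
Qed.

End InFset.
End AffineLines.

(** * Passing from affine flats to linear subspaces *)

Section Homogenization.
Variable F : fieldType.

(** The first [r] rows of the invertible matrix [row_ebase N] are independent, and its first
    [\rank N] rows already span [N]. *)
Lemma row_free_extension m r n (N : 'M[F]_(m, n)) :
    (\rank N <= r)%N -> (r <= n)%N ->
  exists2 M : 'M[F]_(r, n), row_free M & (N <= M)%MS.
Proof.
move=> hr hn; exists (pid_mx r *m row_ebase N).
  by rewrite /row_free mxrankMfree ?row_free_unit ?row_ebase_unit //
    rank_pid_mx.
rewrite -{1}(mulmx_ebase N) submxMr //.
have -> : pid_mx (\rank N) =
    (pid_mx (\rank N) : 'M_(m, r)) *m pid_mx r :> 'M[F]_(m, n).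
  by rewrite mul_pid_mx (minn_idPl hr) (minn_idPr hr).
by rewrite mulmxA submxMl.
Qed.

Variable d : nat.

Definition homogenize (x : 'rV[F]_d) : 'rV[F]_(1 + d) := row_mx 1%:M x.

Lemma homogenize_line (x y z : 'rV[F]_d) : (z - x <= y - x)%MS ->
  (homogenize z <= col_mx (homogenize x) (homogenize y))%MS.
Proof.
move=> /sub_rVP[c hc].
have -> : homogenize z = (1 - c) *: homogenize x + c *: homogenize y.
  rewrite -[z](subrK x) hc /homogenize !scale_row_mx add_row_mx; congr row_mx.
    by rewrite -scalerDl subrK scale1r.
  by rewrite scalerBr scalerBl scale1r [LHS]addrAC -[LHS]addrA [LHS]addrC.
rewrite addmx_sub // scalemx_sub // -addsmxE; [exact: addsmxSl|exact: addsmxSr].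
Qed.

Lemma homogenize_sub0 (x : 'rV[F]_d) (U : 'M[F]_(1 + d)) :
  (homogenize x <= U)%MS -> (0 < \rank U)%N.
Proof.
move=> hx; rewrite lt0n mxrank_eq0; apply: contraTneq hx => ->.
rewrite submx0; apply/eqP => /(congr1 lsubmx); rewrite row_mxKl linear0.
by move/matrixP/(_ 0 0); rewrite !mxE => /eqP; rewrite oner_eq0.
Qed.

(* Intersecting with the hyperplane at infinity drops the rank by one. *)
Lemma homogenize_flat (x0 : 'rV[F]_d) (U : 'M[F]_(1 + d)) : (homogenize x0 <= U)%MS ->
  exists2 N : 'M[F]_(1 + d, d), (\rank N < \rank U)%N &
    forall x, (homogenize x <= U)%MS -> (x - x0 <= N)%MS.
Proof.
move=> hx0; pose X : 'M[F]_(d, 1 + d) := row_mx 0 1%:M.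
pose P : 'M[F]_(1 + d, d) := col_mx 0 1%:M.
have hP m (A : 'M[F]_(m, 1)) (B : 'M[F]_(m, d)) : row_mx A B *m P = B.
  by rewrite mul_row_col mulmx0 add0r mulmx1.
exists ((U :&: X)%MS *m P) => [|x hx].
  apply: leq_ltn_trans (mxrankM_maxl _ _) _; apply: rank_ltmx.
  rewrite ltmxE capmxSl /=; apply/negP => h.
  have /submxP[D] : (homogenize x0 <= X)%MS.
    exact: submx_trans (submx_trans hx0 h) (capmxSr _ _).
  rewrite mul_mx_row mulmx0 => /(congr1 lsubmx); rewrite !row_mxKl.
  by move/matrixP/(_ 0 0); rewrite !mxE => /eqP; rewrite oner_eq0.
have e : homogenize x - homogenize x0 = row_mx 0 (x - x0).
  by rewrite opp_row_mx add_row_mx subrr.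
rewrite -(hP _ 0 (x - x0)) submxMr // sub_capmx -{1}e addmx_sub ?eqmx_opp //=.
have -> : row_mx 0 (x - x0) = (x - x0) *m X by rewrite mul_mx_row mulmx0 mulmx1.
exact: submxMl.
Qed.

Lemma flat_extension k m (p : 'rV[F]_d) (N : 'M[F]_(m, d)) :
    (\rank N <= k)%N -> (k <= d)%N ->
  exists2 H, affine_flat k H & forall x, (x - p <= N)%MS -> H x.
Proof.
move=> hN hk; have [M hM hNM] := row_free_extension hN hk.
exists [set x | (x - p <= M)%MS]%classic; first by exists p, M.
by move=> x hx; exact: submx_trans hx hNM.
Qed.

End Homogenization.

(** * The well-spread case, the nearly planar case and the conclusion *)

(** With [n] points in all, a subspace of rank 1, 2 or 3 may contain at most [n/4], [n/2] or [3n/4]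
    lifted points. Rank 1 gives one point. Rank 3 gives a plane, with at most [n/2 + 1] points. Rank
    2 gives a line, which together with one more point lies in a plane and so has at most [n/2]
    points. *)
Lemma well_spread_homogenize (R : realType) (V : {fset 'rV[R[i]]_3}) :
    (4 <= #|` V|)%N ->
    (forall H, is_plane H -> (2 * #|trace_set V H| <= #|` V| + 2)%N) ->
    (forall H, is_plane H -> exists i : V, ~ H (val i)) ->
  well_spread (fun i : V => homogenize (val i)).
Proof.
move=> n4 hplane hnot U; rewrite -cardfE; set S := [set i : V | _].
have [->|[i0 hi0]] := set_0Vmem S; first by rewrite cards0 muln0.
rewrite inE in hi0; have U0 := homogenize_sub0 hi0.
have [N rN hN] := homogenize_flat hi0.
have Sn : (#|S| <= #|` V|)%N by rewrite cardfE max_card.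
have plane m (N' : 'M[R[i]]_(m, 3)) (S' : {set V}) : (\rank N' <= 2)%N ->
    (forall i, i \in S' -> (val i - val i0 <= N')%MS) -> (2 * #|S'| <= #|` V| + 2)%N.
  move=> rN' hS'; have [H hH hH'] := @flat_extension _ _ 2 _ (val i0) N' rN' isT.
  apply: leq_trans (hplane _ hH); rewrite leq_mul2l subset_leq_card ?orbT //.
  by apply/fintype.subsetP => i /hS' h; apply/trace_setP/hH'.
have hSN i : i \in S -> (val i - val i0 <= N)%MS by rewrite inE => /hN.
case: (ltngtP (\rank U) 2) => [r1|r3|r2].
- have S1 : S \subset [set i0].
    apply/fintype.subsetP => i /hSN; have -> : N = 0.
      by apply/eqP; rewrite -mxrank_eq0; move: r1 rN; lia.
    by move=> /submx0null/eqP; rewrite subr_eq0 inE => /eqP/val_inj ->.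
  have := subset_leq_card S1; rewrite cards1; nia.
- have : (\rank U <= 4)%N by exact: rank_leq_row.
  rewrite leq_eqVlt => /orP[/eqP ->|r4]; first nia.
  have rU : \rank U = 3%N by apply/eqP; rewrite eqn_leq r3 andbT.
  have rN2 : (\rank N <= 2)%N by move: rN; rewrite rU.
  have := plane _ _ _ rN2 hSN; rewrite rU; move: n4; move: #|S| #|` V| => s v; lia.
- have rN1 : (\rank N <= 1)%N by move: rN; rewrite r2.
  (* An auxiliary plane through the line serves to find a point [i1] off the line; the plane spanned
     by the line and [i1] then contains one point more than [S]. *)
  have [H hH hH'] := @flat_extension _ _ 2 _ (val i0) N (leqW rN1) isT.
  have [i1 hi1] := hnot _ hH.
  have h1S : i1 \notin S by apply/negP => /hSN/hH'.
  have := plane _ (col_mx N (val i1 - val i0)) (i1 |: S).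
  rewrite cardsU1 h1S r2 => h; suff : (2 * (true + #|S|) <= #|` V| + 2)%N by nia.
  apply: h => [|i].
    rewrite -addsmxE (leq_trans (mxrank_adds_leqif _ _).1) //.
    exact: leq_add rN1 (rank_leq_row _).
  rewrite -addsmxE => /setU1P[->|/hSN h]; first exact: addsmxSr.
  exact: submx_trans h (addsmxSl _ _).
Qed.

(** The ordered pairs on ordinary lines split into two halves exchanged by swapping, according to
    the order of [enum_rank]; one half counts distinct lines. *)
Lemma num_ordinary_lines_spread (R : realType) (V : {fset 'rV[R[i]]_3}) :
    (0 < #|` V|)%N -> well_spread (fun i : V => homogenize (val i)) ->
  (3 * #|` V| <= 2 * num_ordinary_lines V)%N.
Proof.
move=> V0 hw; rewrite cardfE in V0 *.
have hspan (i j k : V) : k \in line_set i j ->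
    (homogenize (val k) <= col_mx (homogenize (val i)) (homogenize (val j)))%MS.
  by rewrite inE; exact: homogenize_line.
have h := ordinary_pairs_ge (d := 4) isT V0 hw (@line_set_mem _ _ V)
  (@line_set_eq _ _ V) hspan erefl.
apply: leq_trans h _.
set D := finset _.
pose E := [set p in D | (enum_rank p.1 < enum_rank p.2)%N].
have swapK : involutive (fun p : V * V => (p.2, p.1)) by case.
pose E' := [set p in D | (enum_rank p.2 < enum_rank p.1)%N].
have line_setC (i j : V) : i != j -> line_set j i = line_set i j.
  move=> hij; have /andP[hi hj] := line_set_mem i j.
  by apply: line_set_eq => //; rewrite eq_sym.
have DU : D = E :|: E'.
  apply/setP => -[i j]; rewrite !inE /=.
  have [//|hij] := eqVneq i j; rewrite -andb_orr /=.
  case: ltngtP => [||h]; rewrite ?andbT // andbF.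
  by move/ord_inj/enum_rank_inj: h hij => ->; rewrite eqxx.
have EE' : #|E'| = #|E|.
  rewrite -(card_imset (mem E) (inv_inj swapK)); apply: eq_card => -[i j].
  apply/idP/imsetP => [|[[k l] hk [-> ->]]].
    rewrite !inE /= => /andP[/andP[hij hc] hr]; exists (j, i) => //.
    by rewrite !inE /= eq_sym hij line_setC // hc.
  by move: hk; rewrite !inE /= => /andP[/andP[hij hc] ->]; rewrite eq_sym hij line_setC // hc.
rewrite DU; apply: leq_trans (leq_card_setU _ _) _; rewrite EE' addnn -mul2n leq_mul2l /=.
apply: num_ordinary_lines_ge => i j; rewrite !inE /= => /andP[/andP[hij /eqP hc] hr].
split=> //; rewrite negb_and; apply/orP; right.
by rewrite -leqNgt ltnW.
Qed.

Local Open Scope classical_set_scope.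
Local Open Scope fset_scope.
Local Open Scope ring_scope.

Theorem theorem1p8 (R : realType) (n : nat) (V : {fset 'rV[R[i]]_3})
    (hV : #|` V| = n) (hn : (24 <= n)%N)
    (hplane : ~ exists H : set 'rV[R[i]]_3, is_plane H /\ ([set` V] `<=` H)%classic) :
  ((~ exists H : set 'rV[R[i]]_3,
        is_plane H /\ #|` points_in V H| = (n - 1)%N) ->
     3 / 2 * n%:R <= (num_ordinary_lines V)%:R :> R)
  /\
  ((exists H : set 'rV[R[i]]_3,
        is_plane H /\ #|` points_in V H| = (n - 1)%N) ->
     (n - 1 <= num_ordinary_lines V)%N).
Proof.
have cardC H : (#|trace_set V H| + #|(~: trace_set V H)%SET| = n)%N.
  by rewrite cardsC -cardfE.
split=> [hno|[H [hH]]]; last first.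
  (* With a single point off the plane, the bound for flats reads [1 * (n - 1)]. *)
  rewrite card_points_in => hc; have := num_ordinary_lines_flat V hH.
  have := cardC H; rewrite hc => hC.
  have -> : #|(~: trace_set V H)%SET| = 1%N by move: hC; lia.
  by move: hn; lia.
suff h : (3 * n <= 2 * num_ordinary_lines V)%N.
  have : (3 * n)%:R <= (2 * num_ordinary_lines V)%:R :> R by rewrite ler_nat.
  by rewrite !natrM; lra.
have hout H : is_plane H -> exists i : V, ~ H (val i).
  move=> hH; apply: contrapT => hall; apply: hplane; exists H; split=> // x hx.
  by apply: contrapT => hx'; apply: hall; exists [` hx].
(* The threshold is the exact negation of the plane bound [2 a <= n + 2] used for spreading. *)
have [[H [hH hbig]]|hsmall] :=
  pselect (exists H, is_plane H /\ (n + 3 <= 2 * #|trace_set V H|)%N).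
  have := num_ordinary_lines_flat V hH; have := cardC H.
  have [i hi] := hout _ hH.
  have k0 : (0 < #|(~: trace_set V H)%SET|)%N.
    by apply/card_gt0P; exists i; rewrite finset.in_setC; apply/trace_setP.
  have k1 : #|(~: trace_set V H)%SET| <> 1%N.
    move=> k1; apply: hno; exists H; split=> //.
    by rewrite card_points_in; have := cardC H; rewrite k1; lia.
  move: k0 k1 hbig; set k := #|(~: _)%SET|; set a := #|trace_set V H|.
  move=> k0 k1 hbig hak hle.
  suff : (3 * n <= 2 * (k * (a.+1 - k)))%N by lia.
  (* Here [k >= 2] and [a >= k + 3], so neither subtraction truncates. Expanding gives
     [2 k (a + 1 - k) >= 4n - 12], which is at least [3n] for [n >= 24]. *)
  have : (0 <= (k - 2) * (a - k - 3))%N by [].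
  nia.
rewrite -hV; apply: num_ordinary_lines_spread; first by rewrite hV; lia.
apply: well_spread_homogenize => [|H hH|//]; rewrite hV; first lia.
by rewrite leqNgt; apply/negP => h; apply: hsmall; exists H; split=> //; lia.
Qed.
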